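(* Let $1\le p,q\le\infty$ with $\frac1p+\frac1q\ge1$, let $X_1,\dots,X_n,Y$ be Banach spaces and let $\beta$ be a reasonable crossnorm on $X_1\otimes\dots\otimes X_n$. Then for every $u\in X_1\otimes\dots\otimes X_n\otimes Y$ $$\alpha_{p,q}^\beta(u;X_1,\dots,X_n,Y)=\inf\alpha_{p,q}^{\beta|}(u;E_1,\dots,E_n,F),$$ where the infimum is taken over all finite dimensional subspaces $E_i$ of $X_i$, $1\le i\le n$, and $F$ of $Y$ such that $E_1\otimes\dots\otimes E_n\otimes F$ contains $u$.
   Context: All Banach spaces are over the same field $\mathbb K\in\{\mathbb R,\mathbb C\}$; $s^*$ is the conjugate exponent of $s\in[1,\infty]$; $B_X$ is the closed unit ball. A norm $\beta$ on the algebraic tensor product $X_1\otimes\dots\otimes X_n$ is a reasonable crossnorm if $\varepsilon(u)\le\beta(u)\le\pi(u)$ for all $u$, where $\varepsilon$ and $\pi$ are the injective and projective tensor norms. If $E_i\subset X_i$ are closed subspaces, $\beta|$ denotes the restriction of $\beta$ to $E_1\otimes\dots\otimes E_n$, which is a reasonable crossnorm there. $\Sigma_{X_1\dots X_n}=\{x^1\otimes\dots\otimes x^n:x^i\in X_i\}$. $\mathcal L^\beta(X_1,\dots,X_n)$ is the Banach space of multilinear forms $\varphi$ whose linearization $\widetilde\varphi:(X_1\otimes\dots\otimes X_n,\beta)\to\mathbb K$ is bounded, with norm $\|\varphi\|_\beta=\|\widetilde\varphi\|$. For finite sequences $(a_i),(b_i)$ in $\Sigma_{X_1\dots X_n}$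 and $(y_i)$ in $Y$: $\|(a_i-b_i)_{i=1}^m\|_s^{w,\beta}=\sup_{\varphi\in B_{\mathcal L^\beta(X_1,\dots,X_n)}}\big(\sum_i|\widetilde\varphi(a_i)-\widetilde\varphi(b_i)|^s\big)^{1/s}$ and $\|(y_i)_{i=1}^m\|_s^w=\sup_{y^*\in B_{Y^*}}\big(\sum_i|y^*(y_i)|^s\big)^{1/s}$ (maxima over $i$ if $s=\infty$). With $r\in[1,\infty]$ determined by $1=\frac1r+\frac1{q^*}+\frac1{p^*}$, the Laprest\'e norm on $X_1\otimes\dots\otimes X_n\otimes Y$ is $$\alpha_{p,q}^\beta(u)=\alpha_{p,q}^\beta(u;X_1,\dots,X_n,Y)=\inf\Big\{\|(\lambda_i)_{i=1}^m\|_r\,\|(a_i-b_i)_{i=1}^m\|_{q^*}^{w,\beta}\,\|(y_i)_{i=1}^m\|_{p^*}^w: u=\sum_{i=1}^m\lambda_i(a_i-b_i)\otimes y_i\Big\},$$ the infimum over all representations with $\lambda_i\in\mathbb K$, $a_i,b_i\in\Sigma_{X_1\dots X_n}$, $y_i\in Y$. $\alpha_{p,q}^{\beta|}(u;E_1,\dots,E_n,F)$ is the same quantity for the spaces $E_1,\dots,E_n,F$ and the crossnorm $\beta|$. *)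

(* Defs.v *)
From HB Require Import structures.
From mathcomp Require Import all_boot all_order all_algebra.
From mathcomp Require Import complex.
From mathcomp Require Import lra.
From mathcomp Require Import boolp classical_sets functions.
From mathcomp Require Import reals ereal topology normedtype exp hoelder.

Set Implicit Arguments.
Unset Strict Implicit.
Unset Printing Implicit Defensive.

Import Order.TTheory GRing.Theory Num.Theory.
Import numFieldNormedType.Exports.

Local Open Scope classical_set_scope.
Local Open Scope ring_scope.

Inductive scalar_kind := RealScalars | ComplexScalars.

Definition scalars (R : realType) (k : scalar_kind) : numFieldType :=
  match k with
  | RealScalars => R
  | ComplexScalars => R[i]
  end.

Definition real_part (R : realType) (k : scalar_kind) : scalars R k -> R :=
  match k with
  | RealScalars => fun x => x
  | ComplexScalars => fun z => complex.Re z
  end.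

(* In a normed module over K the norm takes its values in K itself; over the
   complex numbers these are complex numbers with null imaginary part. *)
Definition rnorm (R : realType) (k : scalar_kind)
  (V : normedZmodType (scalars R k)) (x : V) : R := real_part `|x|.

Section LinearSubspaces.
Variables (K : numFieldType) (V : lmodType K).

Record lsubspace := LSubspace {
  lsubspace_pred :> {pred V};
  lsubspace_closed : submod_closed lsubspace_pred }.

Definition lsub (S : lsubspace) : Type := {x : V | x \in lsubspace_pred S}.

Section Span.
Variables (D : Type) (e : D -> V).

Definition span_pred : {pred V} := fun u =>
  `[< exists s : seq (K * D), u = \sum_(cd <- s) cd.1 *: e cd.2 >].

Lemma span_closed : submod_closed span_pred.
Proof.
split=> [|a u v]; first by apply/asboolP; exists [::]; rewrite big_nil.
move=> /asboolP[s ->] /asboolP[t ->]; apply/asboolP.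
exists ([seq (a * cd.1, cd.2) | cd <- s] ++ t).
rewrite big_cat big_map scaler_sumr; congr (_ + _).
by apply: eq_bigr => cd _; rewrite scalerA.
Qed.

Definition lspan : lsubspace := LSubspace span_closed.

Lemma mem_lspan (d : D) : e d \in lsubspace_pred lspan.
Proof. by apply/asboolP; exists [:: (1, d)]; rewrite big_seq1 scale1r. Qed.
End Span.

Definition finite_dimensional (S : lsubspace) : Prop :=
  exists m (e : 'I_m -> V), lsubspace_pred S =i lsubspace_pred (lspan e).

End LinearSubspaces.

HB.instance Definition _ (K : numFieldType) (V : lmodType K) (S : lsubspace V) :=
  GRing.isSubmodClosed.Build K V (lsubspace_pred S)
    (GRing.submod_closed_semi (lsubspace_closed S)).

HB.instance Definition _ (K : numFieldType) (V : lmodType K) (S : lsubspace V) :=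
  SubChoice.on (lsub S).

HB.instance Definition _ (K : numFieldType) (V : lmodType K) (S : lsubspace V) :=
  [SubChoice_isSubLmodule of lsub S by <:].

Section NormedSubspace.
Variables (K : numFieldType) (V : normedModType K) (S : lsubspace V).

Definition lsub_norm (x : lsub S) : K := `|\val x|.

Lemma lsub_normD x y : lsub_norm (x + y) <= lsub_norm x + lsub_norm y.
Proof. exact: ler_normD. Qed.

Lemma lsub_normZ (a : K) x : lsub_norm (a *: x) = `|a| * lsub_norm x.
Proof. exact: normrZ. Qed.

Lemma lsub_norm0_eq0 x : lsub_norm x = 0 -> x = 0.
Proof. by move=> /normr0_eq0 x0; exact: val_inj. Qed.

HB.instance Definition _ :=
  Lmodule_isNormed.Build K (lsub S) lsub_normD lsub_normZ lsub_norm0_eq0.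

Definition lsub_normed : normedModType K := lsub S.

End NormedSubspace.

Section TensorProduct.
Variables (K : numFieldType) (n : nat).
Implicit Types X : 'I_n -> lmodType K.

Record mform X := MForm {
  mform_fun :> (forall i, X i) -> K;
  mform_linear : forall (x : forall i, X i) (i : 'I_n),
    scalar (fun y : X i => mform_fun (dfwith x y)) }.

(* The algebraic tensor product is realized, as in Ryan's "Introduction to
   Tensor Products of Banach Spaces", inside the space of functionals on the
   multilinear forms: the elementary tensor of x is the evaluation at x. Since
   multilinear forms separate the points of the tensor product, the relations
   between elementary tensors are exactly those that all forms satisfy. *)
Definition mform_eval X (x : forall i, X i) : mform X -> K^o :=
  fun phi => phi x.

Definition tensor X : lmodType K := lsub (lspan (@mform_eval X)).

Definition pure X (x : forall i, X i) : tensor X :=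
  Sub (mform_eval x) (mem_lspan (@mform_eval X) x).

Definition linearization X (phi : mform X) (u : tensor X) : K := \val u phi.

Lemma linearization_pure X (phi : mform X) x :
  linearization phi (pure x) = phi x.
Proof. by []. Qed.

Section Map.
Variables (X X' : 'I_n -> lmodType K) (f : forall i, {linear X i -> X' i}).

Lemma map_dfwith (x : forall i, X i) (i : 'I_n) (y : X i) :
  (fun j => f j (dfwith x y j)) = dfwith (fun j => f j (x j)) (f i y).
Proof.
apply: functional_extensionality_dep => j.
by case: dfwithP => [|j' ij]; rewrite ?dfwith_in // dfwith_out.
Qed.

Lemma mform_comp_subproof (phi : mform X') (x : forall i, X i) (i : 'I_n) :
  scalar (fun y : X i => phi (fun j => f j (dfwith x y j))).
Proof. by move=> a y z; rewrite !map_dfwith linearP mform_linear. Qed.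

Definition mform_comp (phi : mform X') : mform X :=
  @MForm _ (fun x => phi (fun j => f j (x j))) (mform_comp_subproof phi).

Definition tensor_map_val (u : tensor X) : mform X' -> K^o :=
  fun phi => \val u (mform_comp phi).

Lemma tensor_map_subproof (u : tensor X) :
  tensor_map_val u \in lsubspace_pred (lspan (@mform_eval X')).
Proof.
have /asboolP[s us] := valP u; apply/asboolP.
exists [seq (cd.1, fun i => f i (cd.2 i)) | cd <- s].
by apply/funext => phi; rewrite /tensor_map_val us big_map !fct_sumE.
Qed.

Definition tensor_map (u : tensor X) : tensor X' :=
  Sub (tensor_map_val u) (tensor_map_subproof u).

Lemma tensor_map_is_linear : linear tensor_map.
Proof. by move=> a u v; apply: val_inj. Qed.

HB.instance Definition _ := GRing.isLinear.Build K (tensor X) (tensor X') _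
  tensor_map tensor_map_is_linear.

Lemma tensor_map_pure x : tensor_map (pure x) = pure (fun i => f i (x i)).
Proof. exact: val_inj. Qed.

End Map.
End TensorProduct.

Section BinaryTensorProduct.
Variable K : numFieldType.
Implicit Types V W : lmodType K.

(* The space X_1 * ... * X_n * Y is handled as (X_1 * ... * X_n) * Y, which is
   why a binary tensor product with the same construction is needed. *)
Record bform V W := BForm {
  bform_fun :> V -> W -> K;
  bform_linearl : forall w, scalar (bform_fun^~ w);
  bform_linearr : forall v, scalar (bform_fun v) }.

Definition bform_eval V W (x : V * W) : bform V W -> K^o := fun b => b x.1 x.2.

Definition tensor2 V W : lmodType K := lsub (lspan (@bform_eval V W)).

Definition pure2 V W (v : V) (w : W) : tensor2 V W :=
  Sub (bform_eval (v, w)) (mem_lspan (@bform_eval V W) (v, w)).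

Section Map.
Variables (V V' W W' : lmodType K) (f : {linear V -> V'}) (g : {linear W -> W'}).

Definition bform_comp (b : bform V' W') : bform V W.
Proof.
by exists (fun v w => b (f v) (g w)) => ? a ? ?;
  rewrite linearP (bform_linearl, bform_linearr).
Defined.

Definition tensor2_map_val (u : tensor2 V W) : bform V' W' -> K^o :=
  fun b => \val u (bform_comp b).

Lemma tensor2_map_subproof (u : tensor2 V W) :
  tensor2_map_val u \in lsubspace_pred (lspan (@bform_eval V' W')).
Proof.
have /asboolP[s us] := valP u; apply/asboolP.
exists [seq (cd.1, (f cd.2.1, g cd.2.2)) | cd <- s].
by apply/funext => b; rewrite /tensor2_map_val us big_map !fct_sumE.
Qed.

Definition tensor2_map (u : tensor2 V W) : tensor2 V' W' :=
  Sub (tensor2_map_val u) (tensor2_map_subproof u).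

Lemma tensor2_map_pure v w : tensor2_map (pure2 v w) = pure2 (f v) (g w).
Proof. exact: val_inj. Qed.

End Map.
End BinaryTensorProduct.

Section Norms.
Variables (R : realType) (k : scalar_kind).
Local Notation K := (scalars R k).

Definition rabs (a : K) : R := real_part `|a|.

Definition is_norm (V : lmodType K) (N : V -> R) : Prop :=
  [/\ forall u v, N (u + v) <= N u + N v,
      forall a u, N (a *: u) = rabs a * N u
    & forall u, N u = 0 -> u = 0].

Definition opnorm (V : Type) (N : V -> R) (f : V -> K) : \bar R :=
  ereal_sup [set (rabs (f v))%:E | v in [set v | N v <= 1]].

Definition dual_ball (V : normedModType K) : set {scalar V} :=
  [set f | (opnorm (@rnorm R k V) f <= 1)%E].

Section MultilinearForms.
Variables (n : nat) (X : 'I_n -> normedModType K).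

Definition ntensor : lmodType K := tensor (fun i => X i).

Lemma prod_form_subproof (f : forall i, {scalar X i}) (x : forall i, X i) i :
  scalar (fun y : X i => \prod_j f j (dfwith x y j)).
Proof.
have dfE y : \prod_j f j (dfwith x y j) = f i y * \prod_(j | j != i) f j (x j).
  rewrite (bigD1 i)//= dfwith_in; congr (_ * _).
  by apply: eq_bigr => j ji; rewrite dfwith_out// eq_sym.
by move=> a y z; rewrite !dfE linearP mulrDl mulrA.
Qed.

Definition prod_form (f : forall i, {scalar X i}) : mform (fun i => X i) :=
  @MForm _ _ (fun i => X i) (fun x => \prod_j f j (x j)) (prod_form_subproof f).

Definition injective_norm (u : ntensor) : \bar R :=
  ereal_sup [set (rabs (linearization (prod_form f) u))%:E |
    f in [set f | forall i, dual_ball (f i)]].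

Definition projective_norm (u : ntensor) : \bar R :=
  ereal_inf [set z | exists m (x : 'I_m -> forall i, X i),
    u = \sum_j pure (x j) /\ z = (\sum_j \prod_i rnorm (x j i))%:E].

Definition reasonable_crossnorm (beta : ntensor -> R) : Prop :=
  is_norm beta /\
  forall u, (injective_norm u <= (beta u)%:E <= projective_norm u)%E.

Definition segre : set ntensor := range (@pure K n (fun i => X i)).

Definition mform_ball (beta : ntensor -> R) : set (mform (fun i => X i)) :=
  [set phi | (opnorm beta (linearization phi) <= 1)%E].

End MultilinearForms.

Definition lnorm (s : \bar R) (m : nat) (x : 'I_m -> K) : R :=
  match s with
  | s'%:E => (\sum_i rabs (x i) `^ s') `^ s'^-1
  | +oo%E => \big[Num.max/0]_i rabs (x i)
  | -oo%E => 0
  end.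

Definition weak_norm (V : normedModType K) (s : \bar R) (m : nat)
    (y : 'I_m -> V) : \bar R :=
  ereal_sup [set (lnorm s (fun i => f (y i)))%:E | f in @dual_ball V].

Definition weak_norm_diff (n : nat) (X : 'I_n -> normedModType K)
    (beta : ntensor X -> R) (s : \bar R) (m : nat) (a b : 'I_m -> ntensor X)
    : \bar R :=
  ereal_sup [set (lnorm s (fun i => linearization phi (a i)
                                  - linearization phi (b i)))%:E |
    phi in mform_ball beta].

Definition lapreste_exponent (p q : \bar R) : \bar R :=
  (1 - (hoelder_conjugate q)^-1 - (hoelder_conjugate p)^-1)^-1%E.

Lemma lapreste_exponentP (p q : \bar R) :
  (1 <= p)%E -> (1 <= q)%E -> (1 <= p^-1 + q^-1)%E ->
  let r := lapreste_exponent p q in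
  (1 <= r)%E /\
  (r^-1 + (hoelder_conjugate q)^-1 + (hoelder_conjugate p)^-1 = 1)%E.
Proof.
have inv_ge1 (t : \bar R) : (1 <= t)%E ->
    exists2 c : R, (t^-1 = c%:E)%E & 0 <= c <= 1.
  case: t => [t| |]//; last by exists 0; rewrite ?invey ?lexx ?ler01.
  rewrite lee_fin => t1; have t0 : 0 < t := lt_le_trans ltr01 t1.
  by exists t^-1; rewrite ?inver ?gt_eqF// invr_ge0 ltW//= invf_le1.
have conj (t : \bar R) : (1 <= t)%E -> exists2 c : R, (t^-1 = c%:E)%E &
    ((hoelder_conjugate t)^-1 = (1 - c)%:E)%E /\ 0 <= c <= 1.
  move=> t1; have [c tc c01] := inv_ge1 t t1; exists c => //; split=> //.
  have [c' tc' _] := inv_ge1 _ (hoelder_conj_ge1 t1).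
  have t0 : (0 < t)%E := lt_le_trans lte01 t1.
  have := hoelder_conjugate_eq1 (lt_trans (ltNyr 0) t0) (negbT (gt_eqF t0)).
  by rewrite tc tc' -EFinD => -[<-]; rewrite addrC addKr.
move=> p1 q1; have [c pc [pc' /andP[c0 c1]]] := conj p p1.
have [d qd [qd' /andP[d0 d1]]] := conj q q1.
rewrite pc qd /= -EFinD lee_fin => cd.
rewrite /lapreste_exponent inveK pc' qd' -!EFinB -!EFinD; split; last first.
  by congr EFin; lra.
rewrite inver; case: ifPn => [|e0]; first by rewrite leey.
have e1 : 0 < 1 - (1 - d) - (1 - c) by rewrite lt_neqAle eq_sym e0; lra.
by rewrite lee_fin invf_ge1 //; lra.
Qed.

Definition lapreste (n : nat) (X : 'I_n -> normedModType K)
    (Y : normedModType K) (beta : ntensor X -> R) (p q : \bar R)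
    (u : tensor2 (ntensor X) Y) : \bar R :=
  ereal_inf [set z | exists m (lambda : 'I_m -> K) (a b : 'I_m -> ntensor X)
      (y : 'I_m -> Y),
    [/\ forall i, segre (a i), forall i, segre (b i),
        u = \sum_i lambda i *: pure2 (a i - b i) (y i)
      & z = ((lnorm (lapreste_exponent p q) lambda)%:E
             * weak_norm_diff beta (hoelder_conjugate q) a b
             * weak_norm (hoelder_conjugate p) y)%E]].

Section Subspaces.
Variables (n : nat) (X : 'I_n -> normedModType K) (E : forall i, lsubspace (X i)).

Definition subspaces (i : 'I_n) : normedModType K := lsub_normed (E i).

Definition ntensor_incl : {linear ntensor subspaces -> ntensor X} :=
  @tensor_map K n _ (fun i => X i) (fun i => (\val : {linear lsub (E i) -> X i})).

Definition restrict_norm (beta : ntensor X -> R) : ntensor subspaces -> R :=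
  fun v => beta (ntensor_incl v).

Variables (Y : normedModType K) (F : lsubspace Y).

Definition tensor2_incl :
    tensor2 (ntensor subspaces) (lsub_normed F) -> tensor2 (ntensor X) Y :=
  @tensor2_map K _ _ _ _ ntensor_incl (\val : {linear lsub F -> Y}).

End Subspaces.

End Norms.

(* Main.v *)
(* An inclusion of subspaces maps representations to representations, so one
   inequality is immediate once the weak norms are seen not to grow. For the
   other one, the finitely many vectors occurring in a representation of [u]
   span finite dimensional subspaces [E_i] and [F], and the same representation
   read in these subspaces has the same cost: by the Hahn-Banach theorem every
   functional of norm at most 1 on [F], and every functional of norm at most 1
   on [(E_1 * ... * E_n, beta|)], extends to the whole space with norm at most
   1. A linear functional on the tensor product is the linearization of a
   multilinear form, so the extension still is in the ball that defines the
   weak norm. *)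
From HB Require Import structures.
Require Import Defs.
From mathcomp Require Import all_boot all_order all_algebra.
From mathcomp Require Import complex ring lra.
From mathcomp Require Import boolp classical_sets functions.
From mathcomp Require Import reals ereal topology normedtype exp hoelder.

Set Implicit Arguments.
Unset Strict Implicit.
Unset Printing Implicit Defensive.

Import Order.TTheory GRing.Theory Num.Theory.
Import numFieldNormedType.Exports.

Local Open Scope classical_set_scope.
Local Open Scope ring_scope.

(** * Dominated extension of real linear functionals, by Zorn's lemma on graphs *)

Section DominatedExtension.
(* [iota] makes a complex vector space a real one without an instance of the
   real structure. *)
Variables (R : realType) (K : nzRingType) (iota : {rmorphism R -> K}).
Variables (V : lmodType K) (N : V -> R).
Hypothesis N_subadd : forall u v, N (u + v) <= N u + N v.
Hypothesis N_homog : forall a v, 0 <= a -> N (iota a *: v) = a * N v.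

Definition linear_graph (G : set (V * R)) : Prop :=
  G (0, 0) /\ forall a x y, G x -> G y ->
    G (iota a *: x.1 + y.1, a * x.2 + y.2).

Definition dominated_graph (G : set (V * R)) : Prop :=
  linear_graph G /\ forall x, G x -> x.2 <= N x.1.

Lemma linear_graphZ G a x : linear_graph G -> G x -> G (iota a *: x.1, a * x.2).
Proof. by move=> [G0 GD] /(GD a _ _)/(_ G0); rewrite !addr0. Qed.

(** Two values over the same [v] put their difference over [0], where domination bounds it by
    [N 0 = 0]; exchanging the values gives equality. *)
Lemma dominated_graph_functional G v r s :
  dominated_graph G -> G (v, r) -> G (v, s) -> r = s.
Proof.
have N0 : N 0 = 0 by have := N_homog 0 (lexx 0); rewrite rmorph0 scale0r mul0r.
move=> [[G0 GD] GN].
suff le_value r' s' : G (v, r') -> G (v, s') -> r' <= s'.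
  by move=> Gr Gs; apply/eqP; rewrite eq_le !le_value.
move=> Gr Gs; have /GN/= := GD (-1) _ _ Gs Gr.
by rewrite rmorphN1 scaleN1r addNr N0 mulN1r addrC subr_le0.
Qed.

Definition graph_adjoin (G : set (V * R)) v0 c : set (V * R) :=
  [set x | exists t y, G y /\ x = (y.1 + iota t *: v0, y.2 + t * c)].

Lemma sub_graph_adjoin G v0 c : G `<=` graph_adjoin G v0 c.
Proof.
by move=> [v r] Gx; exists 0, (v, r); rewrite rmorph0 scale0r mul0r !addr0.
Qed.

Lemma graph_adjoin_mem G v0 c : linear_graph G -> graph_adjoin G v0 c (v0, c).
Proof.
by move=> [G0 _]; exists 1, (0, 0); rewrite rmorph1 scale1r mul1r !add0r.
Qed.

Lemma linear_graph_adjoin G v0 c :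
  linear_graph G -> linear_graph (graph_adjoin G v0 c).
Proof.
move=> [G0 GD]; split; first exact: sub_graph_adjoin.
move=> a _ _ [t [x [Gx ->]]] [s [y [Gy ->]]].
exists (a * t + s), (iota a *: x.1 + y.1, a * x.2 + y.2); split; first exact: GD.
congr pair => /=; last by ring.
by rewrite rmorphD rmorphM scalerDl scalerDr scalerA addrACA.
Qed.

(** Domination at [y.1 + iota t *: v0], divided by the modulus of [t], bounds [c] from above by
    [N (y.1 + v0) - y.2] if [t > 0] and from below by [y.2 - N (y.1 - v0)] if [t < 0], with [y]
    rescaled. Subadditivity puts every lower bound below every upper bound, so the supremum of the
    lower bounds serves as [c]. *)
Lemma dominated_graph_adjoin G v0 : dominated_graph G ->
  exists c, dominated_graph (graph_adjoin G v0 c).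
Proof.
move=> [Glin GN]; have [G0 GD] := Glin.
pose A := [set x.2 - N (x.1 - v0) | x in G].
have gap x y : G x -> G y -> x.2 - N (x.1 - v0) <= N (y.1 + v0) - y.2.
  move=> Gx Gy; have /GN/= := GD 1 _ _ Gx Gy.
  rewrite rmorph1 scale1r mul1r => xy.
  have := N_subadd (x.1 - v0) (y.1 + v0).
  by rewrite addrACA addNr addr0; lra.
have A0 : A !=set0 by exists (0 - N (0 - v0)); exists (0, 0).
have ubA y : G y -> ubound A (N (y.1 + v0) - y.2).
  by move=> Gy _ [x Gx <-]; exact: gap.
have hsA : has_sup A by split=> //; exists (N (0 + v0) - 0); exact: (ubA (0, 0)).
exists (sup A); split; first exact: linear_graph_adjoin.
move=> _ [t [y [Gy ->]]] /=.
have [t0|t0|->] := ltgtP t 0; last first.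
- by rewrite rmorph0 scale0r mul0r !addr0 GN.
- have tK : t * t^-1 = 1 by rewrite divff ?gt_eqF.
  have /(ubA _) /(ge_sup A0) /= := linear_graphZ t^-1 Glin Gy.
  rewrite -(ler_pM2l t0) mulrBr mulrA tK mul1r -N_homog ?(ltW t0)//.
  by rewrite scalerDr scalerA -rmorphM tK rmorph1 scale1r; lra.
- have t0' : 0 < - t by rewrite oppr_gt0.
  have tK : - t * (- t)^-1 = 1 by rewrite divff ?gt_eqF.
  have Gt := linear_graphZ (- t)^-1 Glin Gy.
  have /= := ub_le_sup hsA.2 (ex_intro2 _ _ _ Gt erefl : A _).
  rewrite -(ler_pM2l t0') mulrBr mulrA tK mul1r -N_homog ?(ltW t0')//.
  rewrite scalerDr scalerA -rmorphM tK rmorph1 scale1r.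
  by rewrite scalerN rmorphN scaleNr opprK; lra.
Qed.

Lemma dominated_extension (G : set (V * R)) : dominated_graph G ->
  exists f : V -> R,
    [/\ forall a u v, f (iota a *: u + v) = a * f u + f v,
        forall v, f v <= N v
      & forall v r, G (v, r) -> f v = r].
Proof.
(* The union with [G] is built into the predicate because of the empty chain: its union is empty,
   and what is left is the dominated graph [G]. *)
move=> domG; pose P (A : set (V * R)) := dominated_graph (A `|` G).
have [F FP Ftot|A [PA maxA]] := @Zorn_bigcup _ P.
  (* Two points of the union of a chain already lie in one member, so linearity and domination pass
     to the union. *)
  have lift2 x y : (\bigcup_(X in F) X `|` G) x -> (\bigcup_(X in F) X `|` G) y ->
      exists2 D, D = G \/ (exists2 X, F X & D = X `|` G) & D x /\ D y.
    move=> [[A FA Ax]|Gx] [[B FB By]|Gy].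
    - have [AB|BA] := Ftot _ _ FA FB.
      + by exists (B `|` G); [right; exists B|split; left=> //; exact: AB].
      + by exists (A `|` G); [right; exists A|split; left=> //; exact: BA].
    - by exists (A `|` G); [right; exists A|split; [left|right]].
    - by exists (B `|` G); [right; exists B|split; [right|left]].
    - by exists G; [left|].
  have domD D : D = G \/ (exists2 X, F X & D = X `|` G) -> dominated_graph D.
    by case=> [->//|[X FX ->]]; exact: FP.
  have subD D : D = G \/ (exists2 X, F X & D = X `|` G) ->
      D `<=` \bigcup_(X in F) X `|` G.
    by case=> [-> x Gx|[X FX ->] x [Xx|Gx]]; [right|left; exists X|right].
  split; [split|].
  - by right; exact: domG.1.1.
  - move=> a x y /lift2/[apply] -[D D_ [Dx Dy]]; apply: (subD _ D_).
    exact: (domD _ D_).1.2.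
  - by move=> x hx; have [D /domD[_ DN] [/DN]] := lift2 _ _ hx hx.
(* A vector missed by the maximal graph could be adjoined, against maximality. *)
have total v : exists r, (A `|` G) (v, r).
  have [c domc] := dominated_graph_adjoin v PA; apply: contrapT => nv.
  set B := graph_adjoin _ v c in domc.
  have AGB : A `|` G `<=` B := @sub_graph_adjoin _ v c.
  apply: (maxA B).
    split; first by move=> x Ax; apply: AGB; left.
    move=> BA; apply: nv; exists c; left; apply: BA.
    exact: graph_adjoin_mem PA.1.
  suff : B `|` G = B by rewrite /P => ->.
  by apply: setUidl => x Gx; apply: AGB; right.
have [f Gf] := choice total; exists f; split=> [a u v|v|v r Gvr].
- by apply: (dominated_graph_functional PA (Gf _)); exact: PA.1.2 (Gf u) (Gf v).
- exact: PA.2 (Gf v).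
- by apply: (dominated_graph_functional PA (Gf v)); right.
Qed.

End DominatedExtension.

(** * Scalars, operator norms and the Hahn-Banach theorem over both fields *)

Section RealAndComplexScalars.
Variables (R : realType) (k : scalar_kind).
Local Notation K := (scalars R k).

Definition real_scalar : {rmorphism R -> K} :=
  match k with
  | RealScalars => idfun
  | ComplexScalars => real_complex R
  end.

Lemma real_part_linear a (z w : K) :
  real_part (real_scalar a * z + w) = a * real_part z + real_part w.
Proof.
rewrite /real_scalar; case: k z w => //= -[x y] [x' y'] /=.
by rewrite mul0r subr0.
Qed.

Lemma real_part_le (z w : K) : z <= w -> real_part z <= real_part w.
Proof. by case: k z w => //= z w; rewrite lecE => /andP[]. Qed.

Lemma real_scalarK (a : R) : real_part (real_scalar a) = a.
Proof. by rewrite /real_scalar; case: k. Qed.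

Lemma real_partK (z : K) : 0 <= z -> real_scalar (real_part z) = z.
Proof.
by rewrite /real_scalar; case: k z => //= z /ger0_real/RRe_real.
Qed.

Lemma rabs_real_scalar (a : R) : rabs (real_scalar a) = `|a|.
Proof.
rewrite /rabs /real_scalar; case: k => //.
by have /= := congr1 (@complex.Re R) (normc_def (real_complex R a));
  rewrite expr0n addr0 sqrtr_sqr.
Qed.

Lemma real_part_le_rabs (z : K) : real_part z <= rabs z.
Proof.
rewrite /rabs; case: k z => [z|z]; first exact: ler_norm.
have := normc_ge_Re z; rewrite lecE /= => /andP[_].
exact/le_trans/ler_norm.
Qed.

Lemma rabsM (z w : K) : rabs (z * w) = rabs z * rabs w.
Proof.
rewrite /rabs normrM -(real_partK (normr_ge0 z)) -(real_partK (normr_ge0 w)).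
by rewrite -rmorphM !real_scalarK.
Qed.

Section NormedModules.
Variable V : normedModType K.

Lemma rnormD (u v : V) : rnorm (u + v) <= rnorm u + rnorm v.
Proof.
have := real_part_linear 1 `|u| `|v|; rewrite rmorph1 !mul1r => <-.
exact/real_part_le/ler_normD.
Qed.

Lemma rnormZ a (v : V) : rnorm (a *: v) = rabs a * rnorm v.
Proof.
rewrite /rnorm /rabs normrZ.
rewrite -(real_partK (normr_ge0 a)) -(real_partK (normr_ge0 v)).
by rewrite -rmorphM !real_scalarK.
Qed.

End NormedModules.

Section Seminorms.
Variables (V : lmodType K) (N : V -> R).
Hypothesis N_subadd : forall u v, N (u + v) <= N u + N v.
Hypothesis N_homog : forall a v, N (a *: v) = rabs a * N v.

(** This trades a supremum over the unit ball for the pointwise domination that Hahn-Banach takes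
    and returns. *)
Lemma opnorm_le1P (f : V -> K) : scalar f ->
  (opnorm N f <= 1)%E <-> forall v, rabs (f v) <= N v.
Proof.
move=> f_lin.
have fZ := GRing.scalable_linear f_lin.
split=> [f1 v|fN]; last first.
  apply: ge_ereal_sup => _ [v /= Nv <-]; rewrite lee_fin.
  exact: le_trans (fN v) Nv.
have fle1 w : N w <= 1 -> rabs (f w) <= 1.
  move=> Nw; rewrite -lee_fin; apply: le_trans f1.
  by apply: ereal_sup_ubound; exists w.
rewrite leNgt; apply/negP => Nf.
have N_ge0 : 0 <= N v.
  have N0 : N 0 = 0.
    by rewrite -(scale0r v) N_homog -(rmorph0 real_scalar) rabs_real_scalar
      normr0 mul0r.
  have := N_subadd v (- v); rewrite subrr N0 -scaleN1r N_homog.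
  by rewrite -(rmorphN1 real_scalar) rabs_real_scalar normrN1; lra.
(* Dividing by [N v] would fail if [N v = 0]; the midpoint is positive, and dividing [v] by it keeps
   [v] in the unit ball while the value of [f] exceeds 1. *)
pose c := (N v + rabs (f v)) / 2.
have [Nvc c0 cf] : [/\ N v < c, 0 < c & c < rabs (f v)] by rewrite /c; split; lra.
have := fle1 (real_scalar c^-1 *: v).
rewrite N_homog fZ rabsM rabs_real_scalar ger0_norm ?invr_ge0 ?(ltW c0)//.
rewrite !ler_pdivrMl// !mulr1 => /(_ (ltW Nvc)).
by rewrite leNgt cf.
Qed.

End Seminorms.
End RealAndComplexScalars.

(** The subspace is given by a linear map [j], so that the same statement serves the inclusion of
    [F] in [Y] and that of the tensor products. The real part of [f] is extended first. *)
Theorem hahn_banach (R : realType) (k : scalar_kind)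
    (V W : lmodType (scalars R k)) (N : V -> R) (j : {linear W -> V})
    (f : W -> scalars R k) :
  (forall u v, N (u + v) <= N u + N v) ->
  (forall a v, N (a *: v) = rabs a * N v) ->
  scalar f -> (forall w, rabs (f w) <= N (j w)) ->
  exists g : V -> scalars R k,
    [/\ scalar g, forall w, g (j w) = f w & forall v, rabs (g v) <= N v].
Proof.
move=> N_subadd N_homog f_lin fN.
(* A graph avoids inverting [j]: domination makes it single-valued. *)
pose G : set (V * R) := [set x | exists w, x = (j w, real_part (f w))].
have domG : dominated_graph (real_scalar R k) N G.
  split; [split|].
  - have f0 : f 0 = 0.
      by rewrite -[X in f X](scale0r 0) (GRing.scalable_linear f_lin) /= mul0r.
    by exists 0; rewrite linear0 f0 -(rmorph0 (real_scalar R k)) real_scalarK.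
  - move=> a _ _ [w ->] [w' ->]; exists (real_scalar R k a *: w + w').
    by rewrite linearP f_lin real_part_linear.
  - by move=> _ [w ->]; exact: le_trans (real_part_le_rabs _) (fN w).
have homog a v : 0 <= a -> N (real_scalar R k a *: v) = a * N v.
  by move=> a0; rewrite N_homog rabs_real_scalar ger0_norm.
have [h [h_lin hN hG]] := dominated_extension N_subadd homog domG.
have {hG} hj w : h (j w) = real_part (f w) by apply: hG; exists w.
have hZ a v : h (real_scalar R k a *: v) = a * h v.
  have h0 : h 0 = 0.
    by have := h_lin (-1) 0 0; rewrite rmorphN1 scaleN1r mulN1r !addNr => ->.
  by have := h_lin a v 0; rewrite h0 !addr0.
have hD u v : h (u + v) = h u + h v.
  by have := h_lin 1 u v; rewrite rmorph1 scale1r mul1r.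
clear domG G homog h_lin.
case: k V W N j f N_subadd N_homog f_lin fN h hN hj hZ hD.
  move=> V W N j f _ N_homog _ _ h hN hj hZ hD.
  exists h; split=> // [a u v|v]; first by rewrite hD (hZ a u).
  rewrite /rabs /= ler_norml hN andbT lerNl -mulN1r -hZ.
  apply: le_trans (hN _) _.
  by rewrite N_homog (rabs_real_scalar RealScalars) normrN1 mul1r.
move=> V W N j f _ N_homog f_lin _ h hN hj hZ hD.
(* A complex linear functional is recovered from its real part by [f w = Re (f w) - i Re (f (i w))];
   the same formula turns [h] into the extension. *)
pose g v : R[i] := Complex (h v) (- h ('i%C *: v)).
have hC x y v : h (Complex x y *: v) = x * h v + y * h ('i%C *: v).
  rewrite -!hZ -hD /= scalerA -scalerDl; congr (h (_ *: _)).
  rewrite -[LHS]/(Complex x y) /real_scalar /=; apply/eqP; rewrite eq_complex /=.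
  by apply/andP; split; apply/eqP; ring.
have g_lin : scalar g.
  move=> [x y] u v; rewrite /g; apply/eqP; rewrite eq_complex /=.
  have iZ : 'i%C *: (Complex x y *: u) = Complex (- y) x *: u :> V.
    rewrite scalerA; congr (_ *: _); apply/eqP.
    by rewrite eq_complex /= !mul0r !mul1r sub0r add0r !eqxx.
  rewrite scalerDr (hD _ v) hD iZ (hC x y) (hC (- y) x).
  by apply/andP; split; apply/eqP; ring.
exists g; split=> // [w|v].
  rewrite /g -linearZ !hj (GRing.scalable_linear f_lin) /=.
  case: (f w) => x y /=; apply/eqP; rewrite eq_complex /=.
  by apply/andP; split; apply/eqP; ring.
(* Rotating [v] by a unimodular scalar turns [g v] into its modulus, a real part,
   which [h] controls. *)
have [gv0|gv_neq0] := eqVneq (g v) 0.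
  have hv0 : h v = 0 by case: gv0.
  by rewrite gv0 /rabs normr0 /= -hv0.
pose c : R[i] := `|g v| / g v.
have rabs_c : rabs (c : scalars R ComplexScalars) = 1.
  by rewrite /rabs /c normrM normfV normr_id divff ?normr_eq0.
have gc : g (c *: v) = `|g v|.
  by rewrite (GRing.scalable_linear g_lin) /= /c divfK.
have := hN (c *: v); rewrite N_homog rabs_c mul1r.
by rewrite -[h _]/(complex.Re (g (c *: v))) gc.
Qed.

(** * Linear functionals on a tensor product as multilinear forms *)

Section LinearFunctionalsOnTensors.
Variables (K : numFieldType) (n : nat) (X : 'I_n -> lmodType K).

Lemma linearization_linear (phi : mform X) : scalar (linearization phi).
Proof. by []. Qed.

(** Tensors are compared by their values on all multilinear forms, each of which is linear in slot
    [i]. *)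
Lemma pure_dfwith_linear (x : forall i, X i) (i : 'I_n) :
  linear (fun y : X i => pure (dfwith x y)).
Proof.
move=> a y z; apply: val_inj; apply/funext => phi.
by rewrite /= /mform_eval mform_linear.
Qed.

Variables (g : tensor X -> K) (g_lin : scalar g).

Lemma form_of_functional_subproof (x : forall i, X i) (i : 'I_n) :
  scalar (fun y : X i => g (pure (dfwith x y))).
Proof. by move=> a y z; rewrite pure_dfwith_linear g_lin. Qed.

Definition form_of_functional : mform X :=
  @MForm _ _ _ (fun x => g (pure x)) form_of_functional_subproof.

(** Both sides are linear in [u] and agree on elementary tensors, which span. *)
Lemma linearization_form_of_functional u :
  linearization form_of_functional u = g u.
Proof.
have /asboolP[s us] := valP u.
have -> : u = \sum_(cd <- s) cd.1 *: pure cd.2.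
  by apply: val_inj; rewrite us raddf_sum.
pose G : {scalar tensor X} :=
  HB.pack g (GRing.isLinear.Build K (tensor X) K *%R g g_lin).
pose L : {scalar tensor X} := HB.pack (linearization form_of_functional)
  (GRing.isLinear.Build K (tensor X) K *%R _
    (linearization_linear form_of_functional)).
rewrite -[LHS]/(L _) -[RHS]/(G _) !linear_sum.
by apply: eq_bigr => cd _; rewrite !linearZ.
Qed.

End LinearFunctionalsOnTensors.

(** * Invariance of the weak norms under passage to subspaces *)

Section Restriction.
Variables (R : realType) (k : scalar_kind).
Local Notation K := (scalars R k).

(** Both suprema run over the same set of values: functionals in the ball of [F] extend to [Y] by
    Hahn-Banach, and those in the ball of [Y] restrict to [F]. *)
Lemma weak_norm_restrict (Y : normedModType K) (F : lsubspace Y) (s : \bar R)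
    m (y : 'I_m -> lsub_normed F) :
  weak_norm s y = weak_norm s (fun i => \val (y i) : Y).
Proof.
rewrite /weak_norm; congr ereal_sup; apply/seteqP; split=> _ [f /= fball <-].
- have /(opnorm_le1P (@rnormD _ _ _) (@rnormZ _ _ _) (linearP f)) fN := fball.
  have [g [g_lin gf gN]] :=
    hahn_banach (j := \val : {linear lsub F -> Y}) (@rnormD _ _ Y)
      (@rnormZ _ _ _) (linearP f) fN.
  pose G : {scalar Y} := HB.pack g (GRing.isLinear.Build K Y K *%R g g_lin).
  exists G.
    exact/(opnorm_le1P (@rnormD _ _ _) (@rnormZ _ _ _) g_lin).
  by congr EFin; congr lnorm; apply/funext => i; exact: gf.
- have /(opnorm_le1P (@rnormD _ _ _) (@rnormZ _ _ _) (linearP f)) fN := fball.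
  have f'_lin : scalar (fun z : lsub_normed F => f (\val z)).
    by move=> a u v; rewrite linearP.
  pose G : {scalar lsub_normed F} := HB.pack (fun z : lsub_normed F => f (\val z))
    (GRing.isLinear.Build K (lsub_normed F) K *%R _ f'_lin).
  exists G => //.
  apply/(opnorm_le1P (@rnormD _ _ _) (@rnormZ _ _ _) f'_lin) => z; exact: fN.
Qed.

Section Tensors.
Variables (n : nat) (X : 'I_n -> normedModType K).
Variables (E : forall i, lsubspace (X i)) (beta : ntensor X -> R).
Hypothesis beta_norm : is_norm beta.

Lemma mform_ballP (phi : mform (fun i => X i)) :
  mform_ball beta phi <-> forall u, rabs (linearization phi u) <= beta u.
Proof.
have [betaD betaZ _] := beta_norm.
exact (opnorm_le1P betaD betaZ (linearization_linear phi)).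
Qed.

Lemma mform_ball_restrictP (phi : mform (fun i => subspaces E i)) :
  mform_ball (restrict_norm beta) phi <->
  forall v, rabs (linearization phi v) <= beta (ntensor_incl E v).
Proof.
have [betaD betaZ _] := beta_norm.
have restrictD u v : restrict_norm beta (u + v) <=
    restrict_norm beta u + restrict_norm (E := E) beta v.
  by rewrite /restrict_norm linearD betaD.
have restrictZ a v : restrict_norm (E := E) beta (a *: v) =
    rabs a * restrict_norm beta v.
  by rewrite /restrict_norm linearZ betaZ.
exact (opnorm_le1P restrictD restrictZ (linearization_linear phi)).
Qed.

Lemma weak_norm_diff_restrict (s : \bar R) m (a b : 'I_m -> ntensor (subspaces E)) :
  weak_norm_diff (restrict_norm beta) s a b =
  weak_norm_diff beta s (ntensor_incl E \o a) (ntensor_incl E \o b).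
Proof.
have [betaD betaZ _] := beta_norm.
rewrite /weak_norm_diff; congr ereal_sup; apply/seteqP; split=> _ [phi /= phi_ball <-].
- have /mform_ball_restrictP phiN := phi_ball.
  have [g [g_lin gphi gN]] :=
    hahn_banach betaD betaZ (linearization_linear phi) phiN.
  exists (form_of_functional g_lin).
    by apply/mform_ballP => u; rewrite linearization_form_of_functional.
  by congr EFin; congr lnorm; apply/funext => i;
    rewrite !linearization_form_of_functional !gphi.
(* By the definition of [tensor_map], linearizing this restricted form at [v] is linearizing [phi]
   at [ntensor_incl E v]. *)
- exists (mform_comp (fun i => (\val : {linear lsub (E i) -> X i})) phi) => //.
  have /mform_ballP phiN := phi_ball.
  apply/mform_ball_restrictP => v; exact (phiN (ntensor_incl E v)).
Qed.

End Tensors.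
End Restriction.

(** * Transfer of representations and comparison of the Lapresté norms *)

Lemma tensor2_map_is_linear (K : numFieldType) (V V' W W' : lmodType K)
  (f : {linear V -> V'}) (g : {linear W -> W'}) : linear (tensor2_map f g).
Proof. by move=> a u v; apply: val_inj. Qed.

HB.instance Definition _ (K : numFieldType) (V V' W W' : lmodType K)
  (f : {linear V -> V'}) (g : {linear W -> W'}) :=
  GRing.isLinear.Build K (tensor2 V W) (tensor2 V' W') _ (tensor2_map f g)
    (tensor2_map_is_linear f g).

Section Lapreste.
Variables (R : realType) (k : scalar_kind).
Local Notation K := (scalars R k).
Variables (n : nat) (X : 'I_n -> normedModType K) (Y : normedModType K).

Lemma tensor2_incl_sum (E : forall i, lsubspace (X i)) (F : lsubspace Y) m
    (lambda : 'I_m -> K) (a b : 'I_m -> ntensor (subspaces E))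
    (y : 'I_m -> lsub_normed F) :
  tensor2_incl (\sum_i lambda i *: pure2 (a i - b i) (y i)) =
  \sum_i lambda i *:
    pure2 (ntensor_incl E (a i) - ntensor_incl E (b i)) (\val (y i) : Y).
Proof.
rewrite /tensor2_incl linear_sum; apply: eq_bigr => i _.
by rewrite linearZ /= tensor2_map_pure linearB.
Qed.

Variable beta : ntensor X -> R.
Hypothesis beta_norm : is_norm beta.
Variables p q : \bar R.

(** Inclusion carries each representation of [v] to one of its image at the same cost, so the left
    infimum runs over a larger set. *)
Lemma lapreste_tensor2_incl (E : forall i, lsubspace (X i)) (F : lsubspace Y)
    (v : tensor2 (ntensor (subspaces E)) (lsub_normed F)) :
  (lapreste beta p q (tensor2_incl v) <= lapreste (restrict_norm beta) p q v)%E.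
Proof.
apply: ereal_inf_le_tmp => _ [m [lambda [a [b [y [aS bS -> ->]]]]]].
have segre_incl (c : 'I_m -> ntensor (subspaces E)) :
    (forall i, segre (c i)) -> forall i, segre (ntensor_incl E (c i)).
  by move=> cS i; have [x _ <-] := cS i; exists (fun j => \val (x j)) => //;
    exact/esym/tensor_map_pure.
exists m, lambda, (ntensor_incl E \o a), (ntensor_incl E \o b),
  (fun i => \val (y i)).
split; [exact: segre_incl|exact: segre_incl|exact: tensor2_incl_sum|].
by rewrite (weak_norm_diff_restrict beta_norm) weak_norm_restrict.
Qed.

Lemma lspan_finite_dimensional (V : lmodType K) m (e : 'I_m -> V) :
  finite_dimensional (lspan e).
Proof. by exists m, e. Qed.

Lemma representation_lift m (a b : 'I_m -> ntensor X)
    (y : 'I_m -> Y) :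
  (forall i, segre (a i)) -> (forall i, segre (b i)) ->
  exists (E : forall i, lsubspace (X i)) (F : lsubspace Y)
      (a' b' : 'I_m -> ntensor (subspaces E)) (y' : 'I_m -> lsub_normed F),
    [/\ forall i, finite_dimensional (E i), finite_dimensional F,
        (forall i, segre (a' i)) /\ (forall i, segre (b' i)),
        ntensor_incl E \o a' = a /\ ntensor_incl E \o b' = b
      & (fun i => \val (y' i)) = y].
Proof.
move=> aS bS.
have /choice[xa xaE] i : exists x, pure x = a i.
  by have [x _ <-] := aS i; exists x.
have /choice[xb xbE] i : exists x, pure x = b i.
  by have [x _ <-] := bS i; exists x.
(* One family lists the [j]-th factors of all [a i] and all [b i], so that a single span contains
   both. *)
pose c j (t : 'I_(m + m)) : X j :=
  match fintype.split t with inl i => xa i j | inr i => xb i j end.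
pose E j := lspan (c j); pose F := lspan y.
have xa_mem i j : xa i j \in lsubspace_pred (E j).
  by have := mem_lspan (c j) (lshift m i); rewrite /c (unsplitK (inl i)).
have xb_mem i j : xb i j \in lsubspace_pred (E j).
  by have := mem_lspan (c j) (rshift m i); rewrite /c (unsplitK (inr i)).
pose xa' i j : subspaces E j := Sub (xa i j) (xa_mem i j).
pose xb' i j : subspaces E j := Sub (xb i j) (xb_mem i j).
exists E, F, (fun i => pure (xa' i)), (fun i => pure (xb' i)),
  (fun i => Sub (y i) (mem_lspan y i)).
split=> [i||||]; try exact: lspan_finite_dimensional.
- by split=> i; [exists (xa' i)|exists (xb' i)].
- split; apply/funext => i /=.
  + rewrite -xaE; exact: tensor_map_pure.
  + rewrite -xbE; exact: tensor_map_pure.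
- by [].
Qed.

Lemma lapreste_finite_dimensional (u : tensor2 (ntensor X) Y) :
  lapreste beta p q u =
  ereal_inf [set z | exists (E : forall i, lsubspace (X i)) (F : lsubspace Y)
      (v : tensor2 (ntensor (subspaces E)) (lsub_normed F)),
    [/\ forall i, finite_dimensional (E i), finite_dimensional F,
        tensor2_incl v = u
      & z = lapreste (restrict_norm beta) p q v]].
Proof.
apply/eqP; rewrite eq_le; apply/andP; split.
  apply: le_ereal_inf_tmp => _ [E [F [v [_ _ <- ->]]]].
  exact: lapreste_tensor2_incl.
apply: le_ereal_inf_tmp => z [m [lambda [a [b [y [aS bS uE zE]]]]]].
have [E [F [a' [b' [y' [Efin Ffin [a'S b'S] [aE bE] yE]]]]]] :=
  representation_lift y aS bS.
pose v := \sum_i lambda i *: pure2 (a' i - b' i) (y' i).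
(* The lifted representation defines an element [v] over [u], whose norm lies between the right-hand
   infimum and the cost [z]. *)
apply: (@le_trans _ _ (lapreste (restrict_norm beta) p q v)).
  apply: ereal_inf_lbound; exists E, F, v; split=> //.
  by rewrite tensor2_incl_sum uE -aE -bE -yE.
apply: ereal_inf_lbound; exists m, lambda, a', b', y'; split=> //.
by rewrite zE (weak_norm_diff_restrict beta_norm) weak_norm_restrict aE bE yE.
Qed.

End Lapreste.

Theorem proposition4p3 (R : realType) (k : scalar_kind) (n : nat)
  (n_gt0 : (0 < n)%N)
  (X : 'I_n -> completeNormedModType (scalars R k))
  (Y : completeNormedModType (scalars R k))
  (beta : ntensor (fun i => X i) -> R)
  (beta_crossnorm : reasonable_crossnorm beta)
  (p q : \bar R) (p_ge1 : (1 <= p)%E) (q_ge1 : (1 <= q)%E)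
  (pq : (1 <= p^-1 + q^-1)%E)
  (u : tensor2 (ntensor (fun i => X i)) Y) :
  lapreste beta p q u =
  ereal_inf [set z | exists (E : forall i, lsubspace (X i)) (F : lsubspace Y)
      (v : tensor2 (ntensor (subspaces E)) (lsub_normed F)),
    [/\ forall i, finite_dimensional (E i), finite_dimensional F,
        tensor2_incl v = u
      & z = lapreste (restrict_norm beta) p q v]]%classic.
Proof. exact: lapreste_finite_dimensional beta_crossnorm.1 p q u. Qed.
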